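(* Let $X$ be a finite rack with structure group $G_X$, and let $m=|X/G_X|$ be the number of $G_X$-orbits on $X$. Let $M$ be a right $\mathbb Q G_X$-module on which all the elements of $X$ act by the same operator. Then $\dim H^n(X,M)=m^n\times\dim M^{G_X}$.
   Context: A rack is a set $X$ with a binary operation $\triangleright$ such that $y\mapsto x\triangleright y$ is a bijection of $X$ for every $x\in X$, and $x\triangleright(y\triangleright z)=(x\triangleright y)\triangleright(x\triangleright z)$ for all $x,y,z\in X$. Its structure group $G_X$ is the group generated by the elements of $X$ with relations $xy=(x\triangleright y)x$; it acts on $X$ from the left, the generator $x$ acting by $y\mapsto x\triangleright y$. $M^{G_X}$ denotes the subspace of $G_X$-invariants of $M$, and dimensions are over $\mathbb Q$. For a right $G_X$-module $M$, $H^\bullet(X,M)$ (rack cohomology) is the cohomology of the complex $C^n(X,M)=\mathrm{Fun}(X^n,M)$, $n\ge0$ (functions $X^n\to M$, $X^0$ a one-point set), with differential $$df(x_1,\ldots,x_{n+1})=\sum_{i=1}^{n+1}(-1)^{i-1}\Big(f(x_1,\ldots,x_{i-1},x_{i+1},\ldots,x_{n+1})-f(x_1,\ldots,x_{i-1},x_i\triangleright x_{i+1},\ldots,x_i\triangleright x_{n+1})\cdot x_i\Big).$$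
   Formalization: M is assumed finite-dimensional over Q; without this the claim fails: for the one-point rack and M = Q[t,t^-1] with the generator acting by t, the invariants are 0 but H^1 = M/(1-t)M has dimension 1. *)

(* Defs.v *)
From HB Require Import structures.
From mathcomp Require Import all_boot all_order all_fingroup all_algebra.
From mathcomp Require Import generic_quotient ring_quotient.
From mathcomp Require Import boolp.

Set Implicit Arguments.
Unset Strict Implicit.
Unset Printing Implicit Defensive.

Import GRing.Theory.
Local Open Scope ring_scope.
Local Open Scope quotient_scope.

HB.mixin Record isRack X := {
  rop : X -> X -> X;
  rop_bij : forall x, bijective (rop x);
  rop_sdistr : forall x y z, rop x (rop y z) = rop (rop x y) (rop x z)
}.

#[short(type="rackType")]
HB.structure Definition Rack := {X of isRack X}.

#[short(type="finRackType")]
HB.structure Definition FinRack := {X of isRack X & Finite X}.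

Notation "x |> y" := (rop x y) (at level 40, left associativity) : ring_scope.

(* The structure group is presented by generators and relations: words in the
   letters x (encoded (x, true)) and x^-1 (encoded (x, false)), modulo the
   smallest congruence containing the free cancellations and the relations
   x y = (x |> y) x. *)
Section StructureGroup.
Variable X : finRackType.

Definition word : Type := seq (X * bool).

Inductive word_eq : word -> word -> Prop :=
| word_eq_refl u : word_eq u u
| word_eq_sym u v : word_eq u v -> word_eq v u
| word_eq_trans u v w : word_eq u v -> word_eq v w -> word_eq u w
| word_eq_cat u u' v v' :
    word_eq u u' -> word_eq v v' -> word_eq (u ++ v) (u' ++ v')
| word_eq_cancel x b : word_eq [:: (x, b); (x, ~~ b)] [::]
| word_eq_rack x y :
    word_eq [:: (x, true); (y, true)] [:: (x |> y, true); (x, true)].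

Definition word_eqb (u v : word) : bool := `[< word_eq u v >].

Lemma word_eqb_equiv : equiv_class_of word_eqb.
Proof.
split=> [u | u v | v u w].
- by apply/asboolP; exact: word_eq_refl.
- by apply/asboolP/asboolP; apply: word_eq_sym.
- by move=> /asboolP uv /asboolP vw; apply/asboolP; apply: word_eq_trans vw.
Qed.

Canonical word_eqb_rel := EquivRelPack word_eqb_equiv.
Canonical word_eqb_enc := defaultEncModRel word_eqb.

Definition structure_group : Type := {eq_quot word_eqb}.
HB.instance Definition _ := EqQuotient.on structure_group.
HB.instance Definition _ := Choice.on structure_group.

Definition winv (u : word) : word := rev [seq (l.1, ~~ l.2) | l <- u].

Definition sg_pi (u : word) : structure_group := \pi u.
Definition sg_one : structure_group := sg_pi [::].
Definition sg_mul (g h : structure_group) : structure_group :=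
  sg_pi (repr g ++ repr h).
Definition sg_inv (g : structure_group) : structure_group :=
  sg_pi (winv (repr g)).

Lemma sg_piP u v : sg_pi u = sg_pi v <-> word_eq u v.
Proof.
rewrite /sg_pi; split=> [/eqP | uv].
- by rewrite piE /= => /asboolP.
- by apply/eqP; rewrite piE /=; apply/asboolP.
Qed.

Lemma sg_reprK g : sg_pi (repr g) = g.
Proof. exact: reprK. Qed.

Lemma word_eq_repr u : word_eq (repr (sg_pi u)) u.
Proof. by apply/sg_piP; rewrite sg_reprK. Qed.

Lemma sg_piM u v : sg_mul (sg_pi u) (sg_pi v) = sg_pi (u ++ v).
Proof. by apply/sg_piP; apply: word_eq_cat; apply: word_eq_repr. Qed.

Lemma winv_cat u v : winv (u ++ v) = winv v ++ winv u.
Proof. by rewrite /winv map_cat rev_cat. Qed.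

Lemma winvK : involutive winv.
Proof.
move=> u; rewrite /winv map_rev revK -map_comp.
by rewrite -[RHS]map_id; apply: eq_map => -[x b] /=; rewrite negbK.
Qed.

Lemma word_eq_winvl u : word_eq (winv u ++ u) [::].
Proof.
elim: u => [|[x b] u IHu]; first exact: word_eq_refl.
rewrite -cat1s winv_cat -catA; apply: word_eq_trans IHu.
apply: word_eq_cat; first exact: word_eq_refl.
rewrite catA -[X in word_eq _ X]cat0s.
apply: word_eq_cat; last exact: word_eq_refl.
by rewrite /winv /= -{2}[b]negbK; exact: word_eq_cancel.
Qed.

Lemma word_eq_winvr u : word_eq (u ++ winv u) [::].
Proof. by rewrite -{1}[u]winvK; exact: word_eq_winvl. Qed.

Lemma sg_mulA : associative sg_mul.
Proof.
move=> g h k; rewrite -[g]sg_reprK -[h]sg_reprK -[k]sg_reprK.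
by rewrite !sg_piM catA.
Qed.

Lemma sg_mul1 : left_id sg_one sg_mul.
Proof. by move=> g; rewrite -[g]sg_reprK sg_piM. Qed.

Lemma sg_mulr1 : right_id sg_one sg_mul.
Proof. by move=> g; rewrite -[g]sg_reprK sg_piM cats0. Qed.

Lemma sg_mulV : left_inverse sg_one sg_inv sg_mul.
Proof.
move=> g; rewrite /sg_inv -{2}[g]sg_reprK sg_piM.
by apply/sg_piP; exact: word_eq_winvl.
Qed.

Lemma sg_mulrV : right_inverse sg_one sg_inv sg_mul.
Proof.
move=> g; rewrite /sg_inv -{1}[g]sg_reprK sg_piM.
by apply/sg_piP; exact: word_eq_winvr.
Qed.

HB.instance Definition _ := isGroup.Build structure_group
  sg_mulA sg_mul1 sg_mulr1 sg_mulV sg_mulrV.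

Definition sg_gen (x : X) : structure_group := sg_pi [:: (x, true)].

Lemma sg_gen_rack x y :
  (sg_gen x * sg_gen y)%g = (sg_gen (x |> y) * sg_gen x)%g.
Proof.
apply: etrans (sg_piM _ _) _; apply: etrans (esym (sg_piM _ _)).
by apply/sg_piP; exact: word_eq_rack.
Qed.

Definition rop_perm (x : X) : {perm X} := perm (bij_inj (rop_bij x)).

Definition letter_act (l : X * bool) (y : X) : X :=
  if l.2 then l.1 |> y else (rop_perm l.1)^-1%g y.

Definition word_act (u : word) (y : X) : X := foldr letter_act y u.

(* The left action of the structure group on X: [sg_act1], [sg_actM] and
   [sg_act_gen] below show that it does not depend on the chosen word. *)
Definition sg_act (g : structure_group) (y : X) : X := word_act (repr g) y.

Lemma word_act_cat u v y : word_act (u ++ v) y = word_act u (word_act v y).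
Proof. exact: foldr_cat. Qed.

Lemma word_act_eq u v : word_eq u v -> word_act u =1 word_act v.
Proof.
elim=> {u v} [u | u v _ IH | u v w _ IH1 _ IH2 | u u' v v' _ IH1 _ IH2 |
  x b | x y] z //.
- by rewrite IH1.
- by rewrite !word_act_cat IH2 IH1.
- have rpE w : rop_perm x w = x |> w by rewrite /rop_perm permE.
  by case: b; rewrite /word_act /letter_act /= -rpE (permKV, permK).
- by rewrite /word_act /letter_act /= rop_sdistr.
Qed.

Lemma sg_act_pi u : sg_act (sg_pi u) =1 word_act u.
Proof. exact/word_act_eq/word_eq_repr. Qed.

Lemma sg_act1 y : sg_act 1%g y = y.
Proof. by rewrite sg_act_pi. Qed.

Lemma sg_actM g h y : sg_act (g * h)%g y = sg_act g (sg_act h y).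
Proof. by rewrite [LHS]sg_act_pi word_act_cat. Qed.

Lemma sg_act_gen x y : sg_act (sg_gen x) y = x |> y.
Proof. by rewrite sg_act_pi. Qed.

Definition sg_orbit (y : X) : {set X} :=
  [set z | `[< exists g : structure_group, sg_act g y = z >]].

Definition sg_orbits : {set {set X}} := [set sg_orbit y | y : X].

End StructureGroup.

(* A right QG-module is a rational vector space with a right action of G by
   linear operators. *)
Record rightModule (G : groupType) (M : lmodType rat) := RightModule {
  ract :> M -> G -> M;
  ract_linear : forall g, linear (ract^~ g);
  ract1 : forall v, ract v 1%g = v;
  ractM : forall v g h, ract v (g * h)%g = ract (ract v g) h
}.

Section Invariants.
Variables (G : groupType) (M : vectType rat) (rho : rightModule G M).

Lemma invariants_subproof :
  exists W : {vspace M}, forall v, v \in W <-> forall g, rho v g = v.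
Proof.
pose inv (W : {vspace M}) := forall v, v \in W -> forall g, rho v g = v.
have rho0 g : rho 0 g = 0.
  by have := ract_linear rho g (-1) 0 0; rewrite !scaleN1r !addNr.
have exW : exists d, `[< exists2 W, inv W & \dim W = d >].
  exists 0%N; apply/asboolP; exists 0%VS; last exact: dimv0.
  by move=> v; rewrite memv0 => /eqP ->.
have leW d : `[< exists2 W, inv W & \dim W = d >] -> (d <= \dim {:M})%N.
  by move=> /asboolP[W _ <-]; exact: dimvS (subvf W).
case: (ex_maxnP exW leW) => d /asboolP[W invW <-] maxW.
exists W => v; split=> [|invv]; first exact: invW.
have invWv : inv (W + <[v]>)%VS.
  move=> _ /memv_addP[w Ww [_ /vlineP[k ->] ->]] g.
  by rewrite addrC ract_linear invv invW.
have leWv : (\dim (W + <[v]>) <= \dim W)%N.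
  by apply: maxW; apply/asboolP; exists (W + <[v]>)%VS.
have /eqP-> : (W == W + <[v]>)%VS by rewrite eqEdim addvSl leWv.
by rewrite memvE addvSr.
Qed.

Definition invariants : {vspace M} := sval (cid invariants_subproof).

Lemma invariantsP v : v \in invariants <-> forall g, rho v g = v.
Proof. exact: (svalP (cid invariants_subproof)). Qed.

End Invariants.

(* The quotient vector space V / W. *)
Section QuotientSpace.
Variables (K : fieldType) (V : vectType K) (W : {vspace V}).

Definition quotv : Type := Quotient.quot W.
HB.instance Definition _ := GRing.Zmodule.on quotv.

Definition quotv_pi (v : V) : quotv := \pi_(Quotient.quot W) v.
Definition quotv_repr (q : quotv) : V := repr (q : Quotient.quot W).

Lemma quotv_piP u v : quotv_pi u = quotv_pi v <-> u - v \in W.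
Proof.
by rewrite Quotient.idealrBE; split=> [uv | /eqP]; [apply/eqP|].
Qed.

Lemma quotv_reprK : cancel quotv_repr quotv_pi.
Proof. exact: reprK. Qed.

Lemma quotv_piD u v : quotv_pi (u + v) = quotv_pi u + quotv_pi v.
Proof. exact: (raddfD (\pi_(Quotient.quot W))). Qed.

Definition quotv_scale (a : K) (q : quotv) : quotv :=
  quotv_pi (a *: quotv_repr q).

Lemma quotv_scale_pi a v : quotv_scale a (quotv_pi v) = quotv_pi (a *: v).
Proof.
by apply/quotv_piP; rewrite -scalerBr memvZ //; apply/quotv_piP/quotv_reprK.
Qed.

Lemma quotv_scaleA a b q :
  quotv_scale a (quotv_scale b q) = quotv_scale (a * b) q.
Proof. by rewrite -[q]quotv_reprK !quotv_scale_pi scalerA. Qed.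

Lemma quotv_scale1 : left_id 1 quotv_scale.
Proof. by move=> q; rewrite -[q]quotv_reprK quotv_scale_pi scale1r. Qed.

Lemma quotv_scaleDr : right_distributive quotv_scale +%R.
Proof.
move=> a p q; rewrite -[p]quotv_reprK -[q]quotv_reprK.
by rewrite -quotv_piD !quotv_scale_pi scalerDr quotv_piD.
Qed.

Lemma quotv_scaleDl q : {morph quotv_scale^~ q : a b / a + b}.
Proof.
by move=> a b; rewrite -[q]quotv_reprK !quotv_scale_pi scalerDl quotv_piD.
Qed.

HB.instance Definition _ := GRing.Zmodule_isLmodule.Build K quotv
  quotv_scaleA quotv_scale1 quotv_scaleDr quotv_scaleDl.

Lemma quotv_pi_is_linear : linear quotv_pi.
Proof. by move=> a u v; rewrite quotv_piD -quotv_scale_pi. Qed.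

HB.instance Definition _ :=
  GRing.isLinear.Build K V quotv _ quotv_pi quotv_pi_is_linear.

Lemma quotv_vect_iso : Vector.axiom (\dim W^C) quotv.
Proof.
pose p := daddv_pi W^C W.
have dxWC : (W^C :&: W = 0)%VS by rewrite capvC capv_compl.
have pW v : v \in W -> p v = 0.
  move=> Wv; apply: (addrI (daddv_pi W W^C v)).
  by rewrite addr0 daddv_pi_add ?capv_compl ?addv_complf ?memvf //
     daddv_pi_id ?capv_compl.
have subp v : v - p v \in W.
  have {1}<- : daddv_pi W^C W v + daddv_pi W W^C v = v.
    by apply: daddv_pi_add; rewrite // addvC addv_complf memvf.
  by rewrite addrAC subrr add0r memv_pi.
pose f (q : quotv) : 'rV_(\dim W^C) :=
  \row_i coord (vbasis W^C) i (p (quotv_repr q)).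
pose g (r : 'rV[K]_(\dim W^C)) : quotv :=
  quotv_pi (\sum_i r 0 i *: (vbasis W^C)`_i).
have f_pi v : f (quotv_pi v) = \row_i coord (vbasis W^C) i (p v).
  apply/rowP=> i; rewrite !mxE; congr (coord _ _ _).
  apply/eqP; rewrite -subr_eq0 -linearB; apply/eqP/pW.
  exact/quotv_piP/quotv_reprK.
exists f.
  move=> a x y; rewrite -[x]quotv_reprK -[y]quotv_reprK -linearP !f_pi.
  by apply/rowP=> i; rewrite !mxE !linearP.
exists g => [q | r].
  rewrite -[q]quotv_reprK f_pi /g; apply/quotv_piP; rewrite -memvN opprB.
  rewrite (eq_bigr (fun i => coord (vbasis W^C) i (p (quotv_repr q)) *:
    (vbasis W^C)`_i)); last by move=> i _; rewrite mxE.
  by rewrite -coord_vbasis ?memv_pi // subp.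
rewrite f_pi; apply/rowP=> i; rewrite mxE /p daddv_pi_id //.
  by rewrite coord_sum_free ?(basis_free (vbasisP _)).
by apply: rpred_sum => j _; rewrite rpredZ ?vbasis_mem ?memt_nth.
Qed.

HB.instance Definition _ := Lmodule_hasFinDim.Build K quotv quotv_vect_iso.

End QuotientSpace.

(* Coefficients are finite-dimensional ([vectType]).  For the one-point rack
   and M = Q[t, t^-1] with the generator acting by t, M has no nonzero
   invariants but H^1 = M / (1 - t) M is one-dimensional. *)
Section RackCohomology.
Variables (X : finRackType) (M : vectType rat).
Variable rho : rightModule (structure_group X) M.

Definition cochain (n : nat) := {ffun {ffun 'I_n -> X} -> M}.

(* (x_1, .., x_{i-1}, x_{i+1}, .., x_{n+1}) *)
Definition omit n (i : 'I_n.+1) (x : {ffun 'I_n.+1 -> X}) : {ffun 'I_n -> X} :=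
  [ffun j => x (lift i j)].

(* (x_1, .., x_{i-1}, x_i |> x_{i+1}, .., x_i |> x_{n+1}) *)
Definition omit_act n (i : 'I_n.+1) (x : {ffun 'I_n.+1 -> X}) :
    {ffun 'I_n -> X} :=
  [ffun j : 'I_n => if (j < i)%N then x (lift i j) else x i |> x (lift i j)].

(* Indices start from 0 here, so (-1)^(i-1) becomes (-1) ^+ i. *)
Definition diff n (f : cochain n) : cochain n.+1 :=
  [ffun x : {ffun 'I_n.+1 -> X} =>
    \sum_(i < n.+1) (-1) ^+ i *:
      (f (omit i x) - rho (f (omit_act i x)) (sg_gen (x i)))].

Lemma diff_is_linear n : linear (@diff n).
Proof.
move=> a f g; apply/ffunP=> x; rewrite !ffunE scaler_sumr -big_split /=.
apply: eq_bigr => i _; rewrite !ffunE ract_linear.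
rewrite scalerA mulrC -scalerA -scalerDr; congr (_ *: _).
by rewrite opprD addrACA -scalerBr.
Qed.

HB.instance Definition _ n :=
  GRing.isLinear.Build rat (cochain n) (cochain n.+1) _ (@diff n)
    (@diff_is_linear n).

Definition cocycles n : {vspace cochain n} := lker (linfun (@diff n)).

Definition coboundaries n : {vspace cochain n} :=
  match n with
  | 0 => 0%VS
  | k.+1 => limg (linfun (@diff k))
  end.

(* Z^n / B^n, the coboundaries being seen inside the space of cocycles. *)
Definition rack_cohomology n : vectType rat :=
  quotv (linfun (@vsval _ _ (cocycles n)) @^-1: coboundaries n)%VS.

End RackCohomology.

(* Main.v *)
Require Import Defs.
From HB Require Import structures.
From mathcomp Require Import all_boot all_order all_fingroup all_algebra.
From mathcomp Require Import generic_quotient boolp zify.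

Set Implicit Arguments.
Unset Strict Implicit.
Unset Printing Implicit Defensive.

Import GRing.Theory.
Local Open Scope ring_scope.

(* Let T be the common operator and let G be the finite group generated by the
   permutations x |> _ .  Averaging the last argument of a cochain gives a
   homotopy between 1 - T and 0, and inserting x in front gives one between the
   action of x on cochains and the identity; hence G, acting diagonally by
   translation, acts trivially on cohomology.  Let P average every argument
   over G separately: P is a chain projection onto the cochains that depend
   only on the orbits of their arguments.  The kernel of P is acyclic, by
   strong induction on the degree: one may assume that the cocycle f is
   diagonally G-invariant, and then d f = 0 reads d (f(x, _)) = (1 - T) f for
   all x, so that the differences between the slices f(x, _) are cocycles of
   lower degree.  On the image of P, d = (1 - T) delta, where delta is the
   differential of the full simplex on the orbits; delta is exact, and counting
   dimensions leaves the functions from (X/G)^n to ker (1 - T). *)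

(** * Averages over finite sets *)

Section Average.
Variables (I : finType) (V : lmodType rat).
Implicit Types (A : {set I}) (F G : I -> V).

Definition avg A F : V := #|A|%:R^-1 *: \sum_(i in A) F i.

Lemma eq_avg A F G : {in A, F =1 G} -> avg A F = avg A G.
Proof. by move=> eqFG; congr (_ *: _); apply: eq_bigr. Qed.

Lemma avg_const A v i : i \in A -> avg A (fun=> v) = v.
Proof.
move=> iA; rewrite /avg sumr_const -scaler_nat scalerA mulVf ?scale1r //.
by rewrite Num.Theory.pnatr_eq0 -lt0n; apply/card_gt0P; exists i.
Qed.

Lemma avgP A a F G : avg A (fun i => a *: F i + G i) = a *: avg A F + avg A G.
Proof.
by rewrite /avg big_split scalerDr -scaler_sumr !scalerA mulrC.
Qed.

Lemma avgB A F G : avg A (fun i => F i - G i) = avg A F - avg A G.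
Proof. by rewrite /avg sumrB scalerBr. Qed.

Lemma avg_reindex A (h : I -> I) F : injective h ->
  (forall i, (h i \in A) = (i \in A)) -> avg A (F \o h) = avg A F.
Proof.
move=> injh hA; congr (_ *: _); rewrite [RHS](reindex_inj injh).
by apply: eq_bigl => i; rewrite hA.
Qed.

End Average.

Lemma avg_linear (I : finType) (V W : lmodType rat) (f : {linear V -> W})
    (A : {set I}) (F : I -> V) :
  f (avg A F) = avg A (fun i => f (F i)).
Proof. by rewrite linearZ linear_sum. Qed.

Lemma mem_lker (K : fieldType) (V W : vectType K) (f : {linear V -> W}) v :
  reflect (f v = 0) (v \in lker (linfun f)).
Proof. by rewrite memv_ker lfunE; exact: eqP. Qed.

(** * Slices, translations and coefficient operators on cochains *)

Section Cochains.
Variables (X : finRackType) (M : vectType rat).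
Local Notation C := (cochain X M).

Definition fcons n (x : X) (y : {ffun 'I_n -> X}) : {ffun 'I_n.+1 -> X} :=
  [ffun i => if unlift ord0 i is Some j then y j else x].

Definition fbehead n (z : {ffun 'I_n.+1 -> X}) : {ffun 'I_n -> X} :=
  [ffun j => z (lift ord0 j)].

Lemma fcons0 n x (y : {ffun 'I_n -> X}) : fcons x y ord0 = x.
Proof. by rewrite ffunE unlift_none. Qed.

Lemma fconsK n x (y : {ffun 'I_n -> X}) : fbehead (fcons x y) = y.
Proof. by apply/ffunP=> j; rewrite !ffunE liftK. Qed.

Lemma fconsE n (z : {ffun 'I_n.+1 -> X}) : fcons (z ord0) (fbehead z) = z.
Proof.
by apply/ffunP=> i; rewrite ffunE; case: unliftP => [j|] ->; rewrite ?ffunE.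
Qed.

(** Currying in the first argument. With [ap_inj], identities between cochains reduce to their
    slices, which is how most inductions below run. *)
Definition ap n (x : X) (f : C n.+1) : C n := [ffun y => f (fcons x y)].
Definition lam n (F : X -> C n) : C n.+1 :=
  [ffun z : {ffun 'I_n.+1 -> X} => F (z ord0) (fbehead z)].

Lemma ap_lam n (F : X -> C n) x : ap x (lam F) = F x.
Proof. by apply/ffunP=> y; rewrite ffunE ffunE fcons0 fconsK. Qed.

Lemma ap_inj n (f g : C n.+1) : (forall x, ap x f = ap x g) -> f = g.
Proof.
move=> fg; apply/ffunP=> z; have /ffunP/(_ (fbehead z)) := fg (z ord0).
by rewrite ffunE [RHS]ffunE fconsE.
Qed.

Lemma ap_is_linear n x : linear (@ap n x).
Proof. by move=> a f g; apply/ffunP=> y; rewrite !ffunE. Qed.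
HB.instance Definition _ n x :=
  GRing.isLinear.Build rat (C n.+1) (C n) _ (@ap n x)
    (@ap_is_linear n x).

Lemma apD n (f g : C n.+1) x : ap x (f + g) = ap x f + ap x g.
Proof. exact: (linearD (@ap _ x)). Qed.
Lemma apB n (f g : C n.+1) x : ap x (f - g) = ap x f - ap x g.
Proof. exact: (linearB (@ap _ x)). Qed.
Lemma apZ n a (f : C n.+1) x : ap x (a *: f) = a *: ap x f.
Proof. exact: (linearZ_LR (@ap _ x)). Qed.
Lemma apP n a (f g : C n.+1) x : ap x (a *: f + g) = a *: ap x f + ap x g.
Proof. exact: (linearP (@ap _ x)). Qed.
Lemma ap_avg (I : finType) (A : {set I}) n (F : I -> C n.+1) x :
  ap x (avg A F) = avg A (fun i => ap x (F i)).
Proof. exact: (avg_linear (@ap _ x)). Qed.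
Lemma ap0 n x : ap x (0 : C n.+1) = 0.
Proof. exact: (linear0 (@ap _ x)). Qed.

Definition transl n (g : {perm X}) (f : C n) : C n :=
  [ffun z : {ffun 'I_n -> X} => f [ffun i => g (z i)]].

Lemma transl_is_linear n g : linear (@transl n g).
Proof. by move=> a f h; apply/ffunP=> y; rewrite !ffunE. Qed.
HB.instance Definition _ n g :=
  GRing.isLinear.Build rat (C n) (C n) _ (@transl n g) (@transl_is_linear n g).

Lemma ap_transl n g (f : C n.+1) x : ap x (transl g f) = transl g (ap (g x) f).
Proof.
apply/ffunP=> y; rewrite !ffunE; congr (f _); apply/ffunP=> i.
by rewrite !ffunE; case: unliftP => [j|] _; rewrite ?ffunE.
Qed.

(** [permM] applies the left factor first, so precomposition is a left action here. *)
Lemma translM n g h (f : C n) : transl (g * h)%g f = transl g (transl h f).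
Proof.
apply/ffunP=> y; rewrite !ffunE; congr (f _).
by apply/ffunP=> i; rewrite !ffunE permM.
Qed.

Lemma transl1 n (f : C n) : transl 1%g f = f.
Proof.
apply/ffunP=> y; rewrite !ffunE; congr (f _).
by apply/ffunP=> i; rewrite !ffunE perm1.
Qed.

Lemma transl_id0 g (f : C 0) : transl g f = f.
Proof. by apply/ffunP=> y; rewrite !ffunE; congr (f _); apply/ffunP=> -[]. Qed.

Section Operator.
Variable T : {linear M -> M}.

Definition opT n (f : C n) : C n := [ffun z => T (f z)].

Lemma opT_is_linear n : linear (@opT n).
Proof. by move=> a f h; apply/ffunP=> y; rewrite !ffunE linearP. Qed.
HB.instance Definition _ n :=
  GRing.isLinear.Build rat (C n) (C n) _ (@opT n) (@opT_is_linear n).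

Lemma ap_opT n (f : C n.+1) x : ap x (opT f) = opT (ap x f).
Proof. by apply/ffunP=> y; rewrite !ffunE. Qed.

Lemma transl_opT n g (f : C n) : transl g (opT f) = opT (transl g f).
Proof. by apply/ffunP=> y; rewrite !ffunE. Qed.

End Operator.

(** * The finite group generated by the permutations [x |> _] *)

Definition inner : {group {perm X}} := <<[set rop_perm x | x : X]>>%G.

Lemma rop_permE (x y : X) : rop_perm x y = x |> y.
Proof. exact: permE. Qed.

Lemma rop_inner (x : X) : rop_perm x \in inner.
Proof. by apply/mem_gen/imsetP; exists x. Qed.

(** In a finite group a subset that contains 1 and is closed under products is a subgroup, which
    takes care of inverses. *)
Lemma inner_ind (P : {perm X} -> Prop) :
    P 1%g -> (forall g h, P g -> P h -> P (g * h)%g) ->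
    (forall x : X, P (rop_perm x)) -> forall g, g \in inner -> P g.
Proof.
move=> P1 PM Pr; pose S := [set g | `[< P g >]].
have grS : group_set S.
  apply/group_setP; split=> [|g h]; rewrite !inE; first exact/asboolP.
  by move=> /asboolP Pg /asboolP Ph; apply/asboolP/PM.
suff: inner \subset Group grS.
  by move=> /subsetP sub g /sub; rewrite inE => /asboolP.
rewrite gen_subG; apply/subsetP=> _ /imsetP[x _ ->].
by rewrite inE; apply/asboolP.
Qed.

(** Self-distributivity makes each generator a rack automorphism. *)
Lemma inner_rop g : g \in inner -> forall x y, g (x |> y) = g x |> g y.
Proof.
move: g; apply: inner_ind => [x y|g h IHg IHh x y|z x y].
- by rewrite !perm1.
- by rewrite !permM IHg IHh.
- by rewrite !rop_permE rop_sdistr.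
Qed.

Lemma rop_perm_inner g x : g \in inner ->
  (g * rop_perm (g x) = rop_perm x * g)%g.
Proof.
by move=> Gg; apply/permP=> y; rewrite !permM !rop_permE inner_rop.
Qed.

(** * Averaging each argument separately, and all arguments diagonally *)

Fixpoint multiavg n : C n -> C n :=
  match n with
  | 0 => id
  | k.+1 => fun f => lam (fun x => avg inner (fun g => multiavg (ap (g x) f)))
  end.

Arguments multiavg : simpl never.

Lemma ap_multiavg n (f : C n.+1) x :
  ap x (multiavg f) = avg inner (fun g => multiavg (ap (g x) f)).
Proof. exact: ap_lam. Qed.

Lemma multiavg_is_linear n : linear (@multiavg n).
Proof.
elim: n => [|n IHn] a f g //; apply: ap_inj => x.
by rewrite apP !ap_multiavg -avgP; apply: eq_avg => h _; rewrite apP IHn.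
Qed.
HB.instance Definition _ n :=
  GRing.isLinear.Build rat (C n) (C n) _ (@multiavg n) (@multiavg_is_linear n).

Lemma multiavgB n (f g : C n) : multiavg (f - g) = multiavg f - multiavg g.
Proof. exact: linearB. Qed.

Lemma avg_innerMl (V : lmodType rat) h (F : {perm X} -> V) : h \in inner ->
  avg inner (fun g => F (h * g)%g) = avg inner F.
Proof.
by move=> Gh; apply: (avg_reindex F (mulgI h)) => g; rewrite groupMl.
Qed.

Lemma avg_innerMr (V : lmodType rat) h (F : {perm X} -> V) : h \in inner ->
  avg inner (fun g => F (g * h)%g) = avg inner F.
Proof.
by move=> Gh; apply: (avg_reindex F (mulIg h)) => g; rewrite groupMr.
Qed.

Lemma multiavg_transl n g (f : C n) : g \in inner ->
  multiavg (transl g f) = multiavg f.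
Proof.
move=> Gg; elim: n f => [|n IHn] f; first exact: transl_id0.
apply: ap_inj => x; rewrite !ap_multiavg.
rewrite -(avg_innerMr (fun k => multiavg (ap (k x) f)) Gg).
by apply: eq_avg => k _; rewrite ap_transl IHn permM.
Qed.

Lemma transl_multiavg n g (f : C n) : g \in inner ->
  transl g (multiavg f) = multiavg f.
Proof.
move=> Gg; elim: n f => [|n IHn] f; first exact: transl_id0.
apply: ap_inj => x; rewrite ap_transl !ap_multiavg avg_linear /=.
rewrite -(avg_innerMl (fun k => multiavg (ap (k x) f)) Gg).
by apply: eq_avg => k _; rewrite IHn permM.
Qed.

Lemma ap_multiavg_inner n g (f : C n.+1) x : g \in inner ->
  ap (g x) (multiavg f) = ap x (multiavg f).
Proof.
move=> Gg; rewrite !ap_multiavg.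
rewrite -(avg_innerMl (fun k => multiavg (ap (k x) f)) Gg).
by apply: eq_avg => k _; rewrite permM.
Qed.

(** The slices of [multiavg f] agree along an orbit, so the second outer average is that of a
    constant. *)
Lemma multiavg_id n (f : C n) : multiavg (multiavg f) = multiavg f.
Proof.
elim: n f => [|n IHn] f //; apply: ap_inj => x; rewrite ap_multiavg.
rewrite -[RHS](avg_const _ (group1 inner)).
apply: eq_avg => g Gg; rewrite ap_multiavg_inner // ap_multiavg avg_linear /=.
by apply: eq_avg => k _; rewrite IHn.
Qed.

Lemma multiavg_opT T n (f : C n) : multiavg (opT T f) = opT T (multiavg f).
Proof.
elim: n f => [|n IHn] f //; apply: ap_inj => x.
rewrite ap_opT !ap_multiavg avg_linear /=.
by apply: eq_avg => k _; rewrite ap_opT IHn.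
Qed.

Definition diagavg n (f : C n) : C n := avg inner (fun g => transl g f).

Lemma transl_diagavg n g (f : C n) : g \in inner ->
  transl g (diagavg f) = diagavg f.
Proof.
move=> Gg; rewrite avg_linear /= -[RHS](avg_innerMl (fun k => transl k f) Gg).
by apply: eq_avg => k _; rewrite translM.
Qed.

Lemma multiavg_diagavg n (f : C n) : multiavg (diagavg f) = multiavg f.
Proof.
rewrite avg_linear /= -[RHS](avg_const _ (group1 inner)).
by apply: eq_avg => g Gg; rewrite multiavg_transl.
Qed.

(** * Averaging the last argument over the whole rack *)

Fixpoint lastavg n : C n.+1 -> C n :=
  match n with
  | 0 => fun f => avg setT (fun x => ap x f)
  | k.+1 => fun f => lam (fun x => lastavg (ap x f))
  end.

Arguments lastavg : simpl never.

Lemma ap_lastavg n (f : C n.+2) x : ap x (lastavg f) = lastavg (ap x f).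
Proof. exact: ap_lam. Qed.

Lemma lastavg_is_linear n : linear (@lastavg n).
Proof.
elim: n => [|n IHn] a f g.
  by rewrite -avgP; apply: eq_avg => x _; rewrite apP.
by apply: ap_inj => x; rewrite apP !ap_lastavg apP IHn.
Qed.
HB.instance Definition _ n :=
  GRing.isLinear.Build rat (C n.+1) (C n) _ (@lastavg n) (@lastavg_is_linear n).

Lemma lastavgB n (f g : C n.+1) : lastavg (f - g) = lastavg f - lastavg g.
Proof. exact: linearB. Qed.

Lemma lastavg_opT T n (f : C n.+1) : lastavg (opT T f) = opT T (lastavg f).
Proof.
elim: n f => [|n IHn] f.
  by rewrite [RHS]avg_linear /=; apply: eq_avg => x _; rewrite ap_opT.
by apply: ap_inj => x; rewrite ap_opT !ap_lastavg ap_opT IHn.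
Qed.

Lemma lastavg_transl n g (f : C n.+1) :
  lastavg (transl g f) = transl g (lastavg f).
Proof.
elim: n f => [|n IHn] f.
  rewrite transl_id0 -[RHS](avg_reindex _ (@perm_inj _ g)).
    by apply: eq_avg => x _; rewrite ap_transl transl_id0.
  by move=> i; rewrite !inE.
by apply: ap_inj => x; rewrite ap_transl !ap_lastavg ap_transl IHn.
Qed.

Definition iota n (v : C n) : C n.+1 := lam (fun=> v).

Lemma ap_iota n (v : C n) x : ap x (iota v) = v.
Proof. exact: ap_lam. Qed.

End Cochains.

Arguments multiavg : simpl never.
Arguments lastavg : simpl never.

(** * The rack differential in terms of slices *)

Section RackComplex.
Variables (X : finRackType) (M : vectType rat).
Variable rho : rightModule (structure_group X) M.
Variable T : {linear M -> M}.
Hypothesis rhoT : forall (x : X) v, rho v (sg_gen x) = T v.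
Local Notation C := (cochain X M).
Local Notation d := (diff rho).
Local Notation opT := (opT T).

Lemma diffB n (f g : C n) : d (f - g) = d f - d g.
Proof. exact: linearB. Qed.

Lemma diffD n (f g : C n) : d (f + g) = d f + d g.
Proof. exact: linearD. Qed.

Lemma fconsS n x (y : {ffun 'I_n -> X}) j : fcons x y (lift ord0 j) = y j.
Proof. by rewrite ffunE liftK. Qed.

Lemma omit_fcons0 n x (y : {ffun 'I_n -> X}) : omit ord0 (fcons x y) = y.
Proof. exact: fconsK. Qed.

Lemma omit_act_fcons0 n x (y : {ffun 'I_n -> X}) :
  omit_act ord0 (fcons x y) = [ffun i => rop_perm x (y i)].
Proof.
by apply/ffunP=> i; rewrite ffunE [RHS]ffunE fcons0 fconsS rop_permE.
Qed.

Lemma lift_lift0 n (i : 'I_n.+1) (j : 'I_n) :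
  lift (lift ord0 i) (lift ord0 j) = lift ord0 (lift i j).
Proof. by apply: val_inj; rewrite /= /bump !add1n ltnS addnS. Qed.

Lemma lift_lift00 n (i : 'I_n.+1) : lift (lift ord0 i) ord0 = ord0.
Proof. exact: val_inj. Qed.

Lemma omit_fconsS n x (y : {ffun 'I_n.+1 -> X}) i :
  omit (lift ord0 i) (fcons x y) = fcons x (omit i y).
Proof.
apply/ffunP=> j; rewrite ffunE; case: (unliftP ord0 j) => [k|] ->.
  by rewrite lift_lift0 !fconsS ffunE.
by rewrite lift_lift00 !fcons0.
Qed.

Lemma omit_act_fconsS n x (y : {ffun 'I_n.+1 -> X}) i :
  omit_act (lift ord0 i) (fcons x y) = fcons x (omit_act i y).
Proof.
apply/ffunP=> j; rewrite ffunE; case: (unliftP ord0 j) => [k|] ->.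
  by rewrite lift_lift0 !fconsS ffunE ltnS.
by rewrite lift_lift00 !fcons0.
Qed.

Lemma ap_diff0 (f : C 0) x : ap x (d f) = f - opT f.
Proof.
apply/ffunP=> y; rewrite ffunE ffunE big_ord1 expr0 scale1r rhoT.
rewrite omit_fcons0 omit_act_fcons0 !ffunE; congr (_ - T (f _)).
by apply/ffunP=> -[].
Qed.

(** The face of index 0 gives the first two terms; the other faces keep x in front, with signs
    shifted by one. This recursion stands in for the alternating sum from here on. *)
Lemma ap_diff n (f : C n.+1) x :
  ap x (d f) = f - opT (transl (rop_perm x) f) - d (ap x f).
Proof.
apply/ffunP=> y; rewrite ffunE ffunE big_ord_recl expr0 scale1r rhoT.
rewrite omit_fcons0 omit_act_fcons0 !ffunE; congr (_ + _).
rewrite -sumrN; apply: eq_bigr => i _.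
rewrite omit_fconsS omit_act_fconsS !rhoT exprS mulN1r scaleNr.
by rewrite !ffunE.
Qed.

Lemma diff_opT n (f : C n) : d (opT f) = opT (d f).
Proof.
elim: n f => [|n IHn] f; apply: ap_inj => x; rewrite ap_opT.
  by rewrite !ap_diff0 linearB.
by rewrite !ap_diff !linearB /= transl_opT ap_opT IHn.
Qed.

Lemma diff_transl n g (f : C n) : g \in inner X ->
  d (transl g f) = transl g (d f).
Proof.
move=> Gg; elim: n f => [|n IHn] f; apply: ap_inj => x; rewrite ap_transl.
  by rewrite !ap_diff0 !transl_id0.
rewrite !ap_diff !linearB /= !transl_opT -!translM rop_perm_inner //.
by rewrite ap_transl IHn.
Qed.

Lemma diff_diff n (f : C n) : d (d f) = 0.
Proof.
elim: n f => [|n IHn] f; apply: ap_inj => x.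
  rewrite ap_diff ap_diff0 linearB /= -diff_transl ?rop_inner // -diff_opT.
  by rewrite transl_id0 subrr ap0.
rewrite ap_diff ap_diff !diffB IHn subr0.
by rewrite diff_opT diff_transl ?rop_inner // subrr ap0.
Qed.

(** The translation by x in [ap_diff] is absorbed by [multiavg], on whichever side of it it
    occurs. *)
Lemma multiavg_diff n (f : C n) : multiavg (d f) = d (multiavg f).
Proof.
elim: n f => [|n IHn] f; apply: ap_inj => x; rewrite ap_multiavg.
  rewrite (eq_avg (G := fun=> f - opT f)); last first.
    by move=> g _; rewrite ap_diff0.
  by rewrite (avg_const _ (group1 (inner X))) ap_diff0.
rewrite ap_diff transl_multiavg ?rop_inner // ap_multiavg avg_linear.
rewrite -[in RHS](avg_const (multiavg f - opT (multiavg f)) (group1 (inner X))).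
rewrite -avgB; apply: eq_avg => g _.
by rewrite ap_diff !multiavgB multiavg_opT multiavg_transl ?rop_inner // IHn.
Qed.

Lemma lastavg_diff0 (f : C 0) (x : X) : lastavg (d f) = f - opT f.
Proof.
rewrite -[RHS](avg_const _ (in_setT x)).
by apply: eq_avg => y _; rewrite ap_diff0.
Qed.

(** Each [x |> _] permutes the values of the last argument, so averaging commutes with every face
    but the last; that one, of index n+1, contributes (1 - T) f with its sign. *)
Lemma lastavg_diff n (f : C n.+1) :
  lastavg (d f) = d (lastavg f) + (-1) ^+ n.+1 *: (f - opT f).
Proof.
elim: n f => [|n IHn] f; apply: ap_inj => x.
  rewrite ap_lastavg ap_diff !lastavgB (lastavg_diff0 _ x).
  rewrite lastavg_opT lastavg_transl transl_id0 apD ap_diff0.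
  by rewrite expr1 scaleN1r [in RHS]opprB apB ap_opT opprB.
rewrite ap_lastavg ap_diff !lastavgB lastavg_opT lastavg_transl IHn.
rewrite apD ap_diff ap_lastavg opprD addrA; congr (_ + _).
by rewrite apZ apB ap_opT [in RHS]exprS mulN1r scaleNr.
Qed.

(** * Triviality of the diagonal action on cohomology *)

Lemma diff_transl_inv n g (f : C n) : g \in inner X -> d f = 0 ->
  d (transl g f) = 0.
Proof. by move=> Gg df; rewrite diff_transl // df linear0. Qed.

Lemma operator_coboundary n (f : C n.+1) : d f = 0 ->
  exists g, f - opT f = d g.
Proof.
move=> df; exists (- ((-1) ^+ n.+1 *: lastavg f)).
have := lastavg_diff f; rewrite df linear0 => /(congr1 ( *:%R ((-1) ^+ n.+1))).
rewrite scaler0 scalerDr scalerA -expr2 sqrr_sign scale1r => /esym/eqP.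
rewrite addrC addr_eq0 => /eqP ->. by rewrite -!linearZ -linearN.
Qed.

(* The slice at x of d f = 0 says that f - T (x . f) = d (f(x, _)), and T acts
   trivially on cohomology by [operator_coboundary]. *)
Lemma transl_coboundary n g (f : C n.+1) : g \in inner X -> d f = 0 ->
  exists u, f - transl g f = d u.
Proof.
(* Membership is carried through the induction: in the product case it keeps the translate by h a
   cocycle. *)
move=> Gg; suff: g \in inner X /\ forall f : C n.+1, d f = 0 ->
  exists u, f - transl g f = d u by case=> _; apply.
move: g Gg; apply: inner_ind => [|g h [Gg IHg] [Gh IHh]|x]; split.
- exact: group1.
- by move=> {}f _; exists 0; rewrite transl1 subrr linear0.
- exact: groupM.
- move=> {}f df; rewrite translM; have [u Du] := IHh f df.
  have [v Dv] := IHg _ (diff_transl_inv Gh df).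
  by exists (u + v); rewrite linearD /= -Du -Dv addrA subrK.
- exact: rop_inner.
move=> {}f df; have Gx := rop_inner x.
have [u Du] := operator_coboundary (diff_transl_inv Gx df).
exists (ap x f - u); rewrite linearB /= -Du.
have /eqP := congr1 (ap x) df; rewrite ap_diff ap0 subr_eq0 => /eqP <-.
by rewrite opprB addrA subrK.
Qed.

Lemma diagavg_coboundary n (f : C n.+1) : d f = 0 ->
  exists u, f = diagavg f + d u.
Proof.
move=> df.
(* Outside the group the primitive defaults to 0, which the average over [inner X] never sees. *)
have /choice[u Du] : forall g : {perm X}, exists u, g \in inner X ->
    f - transl g f = d u.
  move=> g; case: (boolP (g \in inner X)) => [Gg|]; last by exists 0.
  by have [u Du] := transl_coboundary Gg df; exists u.
exists (avg (inner X) u); rewrite avg_linear /= -(eq_avg Du).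
by rewrite avgB (avg_const _ (group1 (inner X))) addrC subrK.
Qed.

(** * Cochains invariant under the diagonal action *)

Lemma iotaB n (u v : C n) : iota (u - v) = iota u - iota v.
Proof. by apply: ap_inj => x; rewrite apB !ap_iota. Qed.

Lemma iota_opT n (u : C n) : iota (opT u) = opT (iota u).
Proof. by apply: ap_inj => x; rewrite ap_opT !ap_iota. Qed.

Definition inv n (f : C n) := forall g, g \in inner X -> transl g f = f.

Lemma inv_rop n (f : C n) (x : X) : inv f -> transl (rop_perm x) f = f.
Proof. by move=> invf; apply/invf/rop_inner. Qed.

Lemma invB n (f g : C n) : inv f -> inv g -> inv (f - g).
Proof. by move=> If Ig h Gh; rewrite linearB /= If ?Ig. Qed.

Lemma invD n (f g : C n) : inv f -> inv g -> inv (f + g).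
Proof. by move=> If Ig h Gh; rewrite linearD /= If ?Ig. Qed.

Lemma inv_opT n (f : C n) : inv f -> inv (opT f).
Proof. by move=> If h Gh; rewrite transl_opT If. Qed.

Lemma inv_iota n (f : C n) : inv f -> inv (iota f).
Proof.
by move=> If h Gh; apply: ap_inj => x; rewrite ap_transl !ap_iota If.
Qed.

Lemma diff_iota n (v : C n) : inv v ->
  d (iota v) = iota (iota v - opT (iota v) - d v).
Proof.
move=> Iv; apply: ap_inj => x.
by rewrite ap_diff (inv_rop x (inv_iota Iv)) !ap_iota.
Qed.

Lemma ap_diff_inv n (f : C n.+1) x : inv f ->
  ap x (d f) = f - opT f - d (ap x f).
Proof. by move=> If; rewrite ap_diff inv_rop. Qed.

(** For invariant f the slice at x is a translate of the slice at [g x], and [multiavg] does not see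
    translations; so averaging the first argument as well changes nothing. *)
Lemma multiavg_ap0 n (f : C n.+1) x : inv f -> multiavg f = 0 ->
  multiavg (ap x f) = 0.
Proof.
move=> If Pf; have <- : ap x (multiavg f) = 0 by rewrite Pf ap0.
rewrite ap_multiavg -[LHS](avg_const _ (group1 (inner X))).
apply: eq_avg => g Gg.
by rewrite -{1}(If g Gg) ap_transl multiavg_transl.
Qed.

Lemma multiavg_iota0 n (v : C n) : multiavg v = 0 -> multiavg (iota v) = 0.
Proof.
move=> Pv; apply: ap_inj => x; rewrite ap_multiavg ap0 -[RHS]Pv.
rewrite -[RHS](avg_const _ (group1 (inner X))).
by apply: eq_avg => g _; rewrite ap_iota.
Qed.

(** A reference slice; unlike a single [ap x f], the mean of all slices inherits the invariance of
    f. *)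
Definition headavg n (f : C n.+1) : C n := avg setT (fun x => ap x f).

Lemma inv_headavg n (f : C n.+1) : inv f -> inv (headavg f).
Proof.
move=> If g Gg; rewrite avg_linear /=.
rewrite -[RHS](avg_reindex _ (@perm_inj _ (g^-1)%g)).
  by apply: eq_avg => x _; rewrite /= -[in RHS](If g Gg) ap_transl permKV.
by move=> x; rewrite !inE.
Qed.

Lemma multiavg_headavg0 n (f : C n.+1) : inv f -> multiavg f = 0 ->
  multiavg (headavg f) = 0.
Proof.
move=> If Pf; rewrite avg_linear /avg big1 ?scaler0 // => x _.
exact: multiavg_ap0.
Qed.

(** * Acyclicity of the kernel of [multiavg] *)

Definition exact_coboundary n : C n -> Prop :=
  match n with
  | 0 => fun f => f = 0
  | k.+1 => fun f => exists2 u : C k, multiavg u = 0 & f = d u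
  end.

Definition acyclic_at n :=
  forall f : C n, d f = 0 -> multiavg f = 0 -> exact_coboundary f.

(** Subtracting [multiavg u] from u does not change d u, because its differential is [multiavg f],
    that is 0. *)
Lemma exact_coboundaryP n (f : C n.+1) u : multiavg f = 0 -> f = d u ->
  exact_coboundary f.
Proof.
move=> Pf fE; exists (u - multiavg u).
  by rewrite multiavgB multiavg_id subrr.
by rewrite diffB -multiavg_diff -fE Pf subr0.
Qed.

(* The slices of v have primitives of P-average 0 by [An]; for n = 0 the slices
   vanish and w = 0. *)
Lemma slice_coboundary n (v : C n.+1) : acyclic_at n -> inv v ->
    multiavg v = 0 -> (forall x, d (ap x v) = 0) ->
  exists w : C n, [/\ inv w, multiavg w = 0 & d w = iota (w - opT w) - v].
Proof.
move=> An Iv Pv dv.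
have {An dv} /= vE x : exact_coboundary (ap x v).
  by apply: An; rewrite ?dv ?multiavg_ap0.
case: n v Iv Pv vE => [|n] v Iv Pv /= vE.
  have -> : v = 0 by apply: ap_inj => x; rewrite vE ap0.
  exists 0; split; [by move=> g _; rewrite linear0 | by [] |].
  by apply: ap_inj => x; rewrite ap_diff0 apB ap_iota ap0 subr0.
have /choice[u uE] x : exists u : C n, multiavg u = 0 /\ ap x v = d u.
  by have [u Pu ->] := vE x; exists u.
(* The chosen primitives are assembled into one cochain, then symmetrised so that [ap_diff_inv]
   applies; invariance of v keeps its slices as their differentials. *)
exists (diagavg (lam u)); split.
- by move=> g Gg; rewrite transl_diagavg.
- rewrite multiavg_diagavg; apply: ap_inj => x; rewrite ap_multiavg ap0.
  by rewrite /avg big1 ?scaler0 // => g _; rewrite ap_lam; case: (uE (g x)).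
apply: ap_inj => x; rewrite apB ap_iota ap_diff_inv; last first.
  by move=> g Gg; rewrite transl_diagavg.
congr (_ - _); rewrite ap_avg avg_linear /=.
rewrite -[RHS](avg_const _ (group1 (inner X))); apply: eq_avg => g Gg.
rewrite ap_transl ap_lam diff_transl //; have [_ <-] := uE (g x).
by rewrite -ap_transl Iv.
Qed.

(** Slicing [d (iota v) = 0] twice shows that the slices of v are cocycles. The z of
    [slice_coboundary] then satisfies d z = (1 - T) iota z - v, and [diff_iota] turns this into d
    (iota z) = iota v. *)
Lemma iota_coboundary n (v : C n) : (forall m, (m <= n)%N -> acyclic_at m) ->
  inv v -> multiavg v = 0 -> d (iota v) = 0 -> exists u, iota v = d u.
Proof.
case: n v => [|n] v IH Iv Pv div.
  by exists 0; rewrite linear0 [v]Pv; apply: ap_inj => x; rewrite ap_iota ap0.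
have [||x|z [Iz _ dz]] := @slice_coboundary n v (IH n (leqnSn n)) => //.
  have := congr1 (ap x) div; rewrite diff_iota // ap_iota ap0.
  move=> /(congr1 (ap x)); rewrite !apB ap_opT ap_iota ap0 ap_diff_inv //.
  by rewrite opprB addrC subrK.
by exists (iota z); rewrite diff_iota // dz -iota_opT -iotaB opprB addrC subrK.
Qed.

(** All slices of f have the differential (1 - T) f, hence so does their mean t, and f - iota t has
    cocycle slices. By [slice_coboundary], f then differs by a coboundary from a cochain that
    ignores its first argument. *)
Lemma acyclic_inv n (f : C n.+1) : (forall m, (m <= n)%N -> acyclic_at m) ->
  inv f -> d f = 0 -> multiavg f = 0 -> exists u, f = d u.
Proof.
move=> IH If df Pf.
have dap x : d (ap x f) = f - opT f.
  have /eqP := congr1 (ap x) df; rewrite ap_diff_inv // ap0 subr_eq0.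
  by move/eqP.
have It := inv_headavg If; have Pt := multiavg_headavg0 If Pf.
have dt x : d (headavg f) = d (ap x f).
  rewrite dap avg_linear -[RHS](avg_const _ (in_setT x)).
  by apply: eq_avg => y _; exact: dap.
have [||x|w [Iw Pw dw]] :=
  @slice_coboundary n (f - iota (headavg f)) (IH n (leqnn n)).
- exact/invB/inv_iota.
- by rewrite multiavgB Pf multiavg_iota0 // subr0.
- by rewrite apB ap_iota diffB (dt x) subrr.
(* Solving [dw] for f gives f = iota v - d w with this v. *)
pose v := w - opT w + headavg f.
have Iv : inv v by apply: invD It; apply/invB/inv_opT.
have Pv : multiavg v = 0.
  by rewrite linearD /= multiavgB multiavg_opT Pw Pt linear0 subr0 addr0.
have fE : f = iota v - d w.
  apply: ap_inj => x; rewrite apB dw apB apB !ap_iota [X in X - _]addrC.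
  by rewrite opprB addrACA subrr addr0 addrC subrK.
have div : d (iota v) = 0.
  by have := df; rewrite fE diffB diff_diff subr0.
have [u vE] := iota_coboundary IH Iv Pv div.
by exists (u - w); rewrite fE vE diffB.
Qed.

Lemma acyclic n : acyclic_at n.
Proof.
elim/ltn_ind: n => -[_ f _ //|n IH f df Pf].
have [u fE] := diagavg_coboundary df.
have dDf : d (diagavg f) = 0.
  by have := df; rewrite {1}fE diffD diff_diff addr0.
have [||||w DfE] := @acyclic_inv n (diagavg f) => //.
- by move=> g Gg; rewrite transl_diagavg.
- by rewrite multiavg_diagavg.
by apply: (exact_coboundaryP (u := w + u)); rewrite // diffD -DfE.
Qed.

(** * The simplicial differential on cochains depending only on orbits *)

Lemma ap_multiavg_fix n (f : C n.+1) x : multiavg f = f ->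
  multiavg (ap x f) = ap x f.
Proof.
move=> Pf; rewrite -Pf ap_multiavg avg_linear /=.
by apply: eq_avg => g _; rewrite multiavg_id.
Qed.

Lemma inv_multiavg n (f : C n) : multiavg f = f -> inv f.
Proof. by move=> <- g Gg; rewrite transl_multiavg. Qed.

(* The simplicial differential sum_i (-1)^i f(.., x_{i-1}, x_{i+1}, ..). *)
Fixpoint delta n : C n -> C n.+1 :=
  match n with
  | 0 => @iota X M 0
  | k.+1 => fun f => lam (fun x => f - delta (ap x f))
  end.

Arguments delta : simpl never.

Lemma ap_delta0 (f : C 0) x : ap x (delta f) = f.
Proof. exact: ap_iota. Qed.

Lemma ap_delta n (f : C n.+1) x : ap x (delta f) = f - delta (ap x f).
Proof. exact: ap_lam. Qed.

Lemma delta_is_linear n : linear (@delta n).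
Proof.
elim: n => [|n IHn] a f g; apply: ap_inj => x; rewrite apP.
  by rewrite !ap_delta0.
by rewrite !ap_delta apP IHn scalerBr opprD addrACA.
Qed.
HB.instance Definition _ n :=
  GRing.isLinear.Build rat (C n) (C n.+1) _ (@delta n) (@delta_is_linear n).

Lemma deltaB n (f g : C n) : delta (f - g) = delta f - delta g.
Proof. exact: linearB. Qed.

Lemma delta_delta n (f : C n) : delta (delta f) = 0.
Proof.
elim: n f => [|n IHn] f; apply: ap_inj => x; rewrite ap_delta ap0.
  by rewrite ap_delta0 subrr.
by rewrite ap_delta deltaB IHn subr0 subrr.
Qed.

Lemma delta_opT n (f : C n) : delta (opT f) = opT (delta f).
Proof.
elim: n f => [|n IHn] f; apply: ap_inj => x; rewrite ap_opT.
  by rewrite !ap_delta0.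
by rewrite !ap_delta ap_opT IHn linearB.
Qed.

Lemma multiavg_delta n (f : C n) : multiavg (delta f) = delta (multiavg f).
Proof.
elim: n f => [|n IHn] f; apply: ap_inj => x; rewrite ap_multiavg.
  rewrite ap_delta0 -[RHS](avg_const _ (group1 (inner X))).
  by apply: eq_avg => g _; rewrite ap_delta0.
rewrite ap_delta ap_multiavg avg_linear /=.
rewrite -[in RHS](avg_const (multiavg f) (group1 (inner X))) -avgB.
by apply: eq_avg => g _; rewrite ap_delta multiavgB IHn.
Qed.

(** Such an f does not distinguish [x |> y] from y, so the two halves of each face differ only by
    T. *)
Lemma diff_multiavg_fix n (f : C n) : multiavg f = f ->
  d f = delta f - opT (delta f).
Proof.
elim: n f => [|n IHn] f Pf; apply: ap_inj => x; rewrite apB ap_opT.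
  by rewrite ap_diff0 ap_delta0.
rewrite ap_diff_inv; last exact: inv_multiavg.
rewrite (IHn _ (ap_multiavg_fix x Pf)) ap_delta [opT (_ - _)]linearB.
by rewrite !opprB addrACA [RHS]addrACA [- _ - _]addrC.
Qed.

(** Slicing at a fixed point contracts the full simplex, and it commutes with T. For empty X there
    are no nonzero cochains in positive degree. *)
Lemma delta_exact n (f : C n.+1) : multiavg f = f -> delta f = 0 ->
  exists2 u, multiavg u = u & f = delta u /\ (opT f = f -> opT u = u).
Proof.
move=> Pf df; case: (pickP (@predT X)) => [x _ | X0]; last first.
  by exists 0; rewrite ?linear0 //; split; [apply: ap_inj => x; have := X0 x|].
exists (ap x f); first exact: ap_multiavg_fix.
split; last by move=> Tf; rewrite -ap_opT Tf.
by have /eqP := congr1 (ap x) df; rewrite ap_delta ap0 subr_eq0 => /eqP.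
Qed.

(** * Dimension count *)

Definition opN n (f : C n) : C n := f - opT f.

Lemma opN_is_linear n : linear (@opN n).
Proof.
by move=> a f g; rewrite /opN linearP opprD addrACA -scalerBr.
Qed.
HB.instance Definition _ n :=
  GRing.isLinear.Build rat (C n) (C n) _ (@opN n) (@opN_is_linear n).

Local Notation P n := (linfun (@multiavg X M n)).
Local Notation N n := (linfun (@opN n)).
Local Notation D n := (linfun (@delta n)).
Local Notation Df n := (linfun (@diff X M rho n)).
Local Notation Z n := (cocycles rho n).
Local Notation B n := (coboundaries rho n).

Lemma mem_multiavg n (f : C n) : reflect (multiavg f = f) (f \in limg (P n)).
Proof.
apply: (iffP memv_imgP) => [[u _ ->]|Pf].
  by rewrite lfunE /= multiavg_id.
by exists f; rewrite ?memvf // lfunE.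
Qed.

Lemma sub_coboundaries n : (B n <= Z n)%VS.
Proof.
case: n => [|n]; first exact: sub0v.
apply/subvP=> _ /memv_imgP[u _ ->]; apply/mem_lker.
by rewrite lfunE /= diff_diff.
Qed.

Lemma dim_rack_cohomology n :
  \dim {: rack_cohomology rho n} = (\dim (Z n) - \dim (B n))%N.
Proof.
rewrite dimvf /= [LHS]dimv_compl dimvf; congr (_ - _)%N.
set f := linfun _; have f0 : (lker f == 0)%VS.
  by apply/lker0P=> u v; rewrite !lfunE /=; exact: val_inj.
rewrite -[LHS](limg_dim_eq (f := f)); last by rewrite (eqP f0) capv0.
rewrite lpreimK //; apply: (subv_trans (sub_coboundaries n)).
apply/subvP=> u Zu.
by apply/memv_imgP; exists (vsproj (Z n) u); rewrite ?memvf // lfunE /= vsprojK.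
Qed.

(** Rank-nullity for P on cocycles and on coboundaries: by [acyclic] the two kernels coincide and
    cancel. *)
Lemma dim_multiavg_cohomology n :
  (\dim (Z n) - \dim (B n) = \dim (P n @: Z n) - \dim (P n @: B n))%N.
Proof.
rewrite -(limg_ker_dim (P n) (Z n)) -(limg_ker_dim (P n) (B n)).
suff -> : (Z n :&: lker (P n) = B n :&: lker (P n))%VS by rewrite subnDl.
apply/eqP; rewrite eqEsubv; apply/andP; split; last first.
  by rewrite capvS ?sub_coboundaries.
rewrite subv_cap capvSr andbT; apply/subvP=> f.
move=> /memv_capP[/mem_lker Zf /mem_lker Pf]; have := acyclic Zf Pf.
case: n f {Zf Pf} => [|n] f /=; first by move->; exact: mem0v.
by case=> u _ ->; apply/memv_imgP; exists u; rewrite ?memvf ?lfunE.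
Qed.

Lemma multiavg_cocycles n : (P n @: Z n = limg (P n) :&: lker (Df n))%VS.
Proof.
apply/vspaceP=> f; apply/memv_imgP/memv_capP.
  move=> [u /mem_lker Zu ->]; split; first by rewrite memv_img ?memvf.
  by apply/mem_lker; rewrite lfunE /= -multiavg_diff Zu linear0.
by move=> [/mem_multiavg Pf Zf]; exists f; rewrite ?lfunE.
Qed.

Lemma multiavg_coboundaries n :
  (P n.+1 @: B n.+1 = Df n @: limg (P n))%VS.
Proof.
rewrite /= -!limg_comp; congr (limg _); apply/lfunP=> f.
by rewrite !comp_lfunE !lfunE /= multiavg_diff.
Qed.

Local Notation K n := (limg (P n) :&: lker (D n))%VS.
Local Notation E n := (limg (P n) :&: lker (N n))%VS.

Lemma delta_img n : (D n @: limg (P n) = K n.+1)%VS.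
Proof.
apply/vspaceP=> f; apply/memv_imgP/memv_capP => [[u /mem_multiavg Pu ->]|].
  rewrite lfunE /=; split.
    by apply/mem_multiavg; rewrite multiavg_delta Pu.
  by apply/mem_lker; rewrite /= delta_delta.
case=> /mem_multiavg Pf /mem_lker /= df.
have [u Pu [fE _]] := delta_exact Pf df.
by exists u; [apply/mem_multiavg | rewrite lfunE].
Qed.

Lemma delta_imgN n : (D n @: E n = K n.+1 :&: lker (N n.+1))%VS.
Proof.
apply/vspaceP=> f; apply/memv_imgP/memv_capP.
  case=> u /memv_capP[/mem_multiavg Pu /mem_lker /= Nu] ->; split.
    by rewrite -delta_img memv_img //; apply/mem_multiavg.
  apply/mem_lker; rewrite lfunE /= /opN -delta_opT -deltaB.
  by rewrite -/(opN u) Nu linear0.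
case=> /memv_capP[/mem_multiavg Pf /mem_lker /= df] /mem_lker /eqP.
rewrite /= subr_eq0 => /eqP Tf.
have [u Pu [fE Tu]] := delta_exact Pf df.
exists u; last by rewrite lfunE.
apply/memv_capP; split; first exact/mem_multiavg.
by apply/mem_lker; rewrite /= /opN Tu -?Tf // subrr.
Qed.

Lemma diff_img n : (Df n @: limg (P n) = N n.+1 @: K n.+1)%VS.
Proof.
rewrite -delta_img -!limg_comp; congr (limg _); apply/lfunP=> f.
by rewrite !comp_lfunE !lfunE /= diff_multiavg_fix ?multiavg_id.
Qed.

(* For empty X the operator T is not determined by rho, and the result needs
   T = 1. *)
Hypothesis T_empty : (X -> False) -> forall v, T v = v.

(** For nonempty X, [delta] is injective in degree 0 and both sides vanish; for empty X, T = 1 makes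
    [N 0] zero. *)
Lemma delta0_ker : (K 0 :&: lker (N 0) = K 0)%VS.
Proof.
apply/capv_idPl/subvP=> f /memv_capP[_ /mem_lker /= df]; apply/mem_lker.
rewrite /= /opN; case: (pickP (@predT X)) => [x _ | X0].
  have := congr1 (ap x) df; rewrite ap_delta0 ap0 => ->.
  by rewrite linear0 subrr.
have -> : opT f = f; last by rewrite subrr.
by apply/ffunP=> y; rewrite ffunE T_empty // => x; have := X0 x.
Qed.

(** Let b_k be the rank of d on im P_k and k_j the dimension of K_j cut with ker N. Then b_k = dim
    K_{k+1} - k_{k+1}, dim im P_k = dim K_k + dim K_{k+1} and dim E_k = k_k + k_{k+1}, so dim im P_n
    - b_n - b_{n-1} = dim E_n. In degree 0 the term b_{n-1} is absent and [delta0_ker] gives dim K_0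
    = k_0. *)
Lemma dim_cohomology_invariant n :
  \dim {: rack_cohomology rho n} = \dim (E n).
Proof.
rewrite dim_rack_cohomology dim_multiavg_cohomology multiavg_cocycles.
have eD k := limg_ker_dim (Df k) (limg (P k)).
have eN k := limg_ker_dim (N k.+1) (K k.+1).
have eK k := limg_ker_dim (D k) (limg (P k)).
have eE k := limg_ker_dim (D k) (E k).
have cK k : (E k :&: lker (D k) = K k :&: lker (N k))%VS.
  by rewrite -!capvA [X in (_ :&: X)%VS]capvC.
have {}eN k : (\dim (K k.+1 :&: lker (N k.+1)) + \dim (Df k @: limg (P k)) =
    \dim (K k.+1))%N by rewrite diff_img eN.
have {}eK k : (\dim (K k) + \dim (K k.+1) = \dim (limg (P k)))%N.
  by rewrite -(eK k) delta_img.
have {}eE k : (\dim (K k :&: lker (N k)) + \dim (K k.+1 :&: lker (N k.+1)) =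
    \dim (E k))%N by rewrite -(eE k) cK delta_imgN.
case: n => [|n].
  rewrite limg0 dimv0 subn0.
  have := eE 0%N; have := eK 0%N; have := eN 0%N; have := eD 0%N.
  rewrite delta0_ker; lia.
rewrite multiavg_coboundaries.
have := eE n.+1; have := eK n.+1; have := eN n.+1; have := eN n.
have := eD n.+1; lia.
Qed.

(** * Orbits, invariants and functions on orbits *)

Lemma word_act_inner (u : word X) :
  exists2 g, g \in inner X & word_act u =1 g.
Proof.
elim: u => [|[x b] u [g Gg gE]]; first by exists 1%g => // y; rewrite perm1.
(* The letter that acts last stands on the right, as [permM] applies the left factor first. *)
exists (g * (if b then rop_perm x else (rop_perm x)^-1))%g.
  by rewrite groupM //; case: b; rewrite ?groupV rop_inner.
move=> y; rewrite permM -gE /= /letter_act /=.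
by case: b; rewrite ?rop_permE.
Qed.

Lemma inner_sg_act g : g \in inner X ->
  exists k : structure_group X, sg_act k =1 g.
Proof.
move: g; apply: inner_ind => [|g h [k kE] [l lE]|x].
- by exists 1%g => y; rewrite sg_act1 perm1.
- by exists (l * k)%g => y; rewrite sg_actM kE lE permM.
- by exists (sg_gen x) => y; rewrite sg_act_gen rop_permE.
Qed.

Lemma sg_orbitE (x : X) : sg_orbit x = orbit 'P (inner X) x.
Proof.
apply/setP=> y; rewrite inE; apply/asboolP/orbitP => [[k <-] | [g Gg <-]].
  have [g Gg gE] := word_act_inner (repr k).
  by exists g; rewrite //= apermE -gE.
by have [k kE] := inner_sg_act Gg; exists k; rewrite kE.
Qed.

Lemma mem_sg_orbits (x : X) : sg_orbit x \in sg_orbits X.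
Proof. exact: imset_f. Qed.

Definition orbit_type : finType := {o : {set X} | o \in sg_orbits X}.

Definition orbit_of (x : X) : orbit_type :=
  exist _ (sg_orbit x) (mem_sg_orbits x).

Lemma card_orbit_type : #|{: orbit_type}| = #|sg_orbits X|.
Proof. exact: card_sig. Qed.

Lemma orbit_of_inner g (x : X) : g \in inner X -> orbit_of (g x) = orbit_of x.
Proof.
move=> Gg; apply: val_inj; rewrite /= !sg_orbitE.
by apply/orbit_eqP/orbitP; exists g.
Qed.

Lemma orbit_of_eq (x y : X) : orbit_of x = orbit_of y ->
  exists2 g, g \in inner X & g x = y.
Proof.
move=> /(congr1 val); rewrite /= !sg_orbitE => /esym/orbit_eqP/orbitP[g Gg gE].
by exists g.
Qed.

Lemma orbit_repr : exists r : orbit_type -> X, cancel r orbit_of.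
Proof.
have /choice[r rE] o : exists x, orbit_of x = o.
  case: o => o o_orb; have /imsetP[x _ oE] := o_orb.
  by exists x; apply: val_inj.
by exists r.
Qed.

(** The first argument moves within its orbit by [ap_multiavg_inner], the others by induction on the
    slice. *)
Lemma multiavg_fixP n (f : C n) : multiavg f = f <->
  (forall z z' : {ffun 'I_n -> X},
    (forall i, orbit_of (z i) = orbit_of (z' i)) -> f z = f z').
Proof.
elim: n f => [|n IHn] f.
  by split=> // _ z z' _; congr (f _); apply/ffunP=> -[].
split=> [Pf z z' zz' | fE].
  have apE y : f y = ap (y ord0) f (fbehead y) by rewrite ffunE fconsE.
  rewrite !apE; have [g Gg <-] := orbit_of_eq (zz' ord0).
  rewrite -Pf ap_multiavg_inner // Pf.
  by apply: (proj1 (IHn _) (ap_multiavg_fix _ Pf)) => i; rewrite !ffunE zz'.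
apply: ap_inj => x; rewrite ap_multiavg.
rewrite -[RHS](avg_const _ (group1 (inner X))); apply: eq_avg => g Gg.
have -> : ap (g x) f = ap x f.
  apply/ffunP=> y; rewrite !ffunE; apply: fE => i.
  by rewrite !ffunE; case: unliftP => [j|] _ //; exact: orbit_of_inner.
apply/IHn => z z' zz'; rewrite !ffunE; apply: fE => i.
by rewrite !ffunE; case: unliftP.
Qed.

Lemma mem_invariants v : reflect (T v = v) (v \in invariants rho).
Proof.
apply: (iffP idP) => [/invariantsP Iv | Tv].
  case: (pickP (@predT X)) => [x _|X0]; first by rewrite -(rhoT x) Iv.
  by apply: T_empty => x; have := X0 x.
apply/invariantsP => k; rewrite -[k]sg_reprK.
have rhox x b : rho v (sg_pi [:: (x, b)]) = v.
  case: b; first by rewrite -[RHS]Tv -(rhoT x).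
  (* For an inverse letter, v is rewritten as T v, which is v acted on by x, and then x cancels with
     its inverse. *)
  rewrite -{1}Tv -(rhoT x) -ractM -[RHS](ract1 rho).
  congr (rho v _); rewrite [LHS]sg_piM; apply/sg_piP.
  exact: (word_eq_cancel x true).
elim: (repr k) => [|[x b] u IHu]; first exact: (ract1 rho).
by rewrite -cat1s -sg_piM [LHS]ractM rhox.
Qed.

Definition of_orbits n (phi : {ffun {ffun 'I_n -> orbit_type} ->
    subvs_of (invariants rho)}) : C n :=
  [ffun z : {ffun 'I_n -> X} => vsval (phi [ffun i => orbit_of (z i)])].

Lemma of_orbits_is_linear n : linear (@of_orbits n).
Proof. by move=> a f g; apply/ffunP=> z; rewrite !ffunE linearP. Qed.
HB.instance Definition _ n :=
  GRing.isLinear.Build rat _ (C n) _ (@of_orbits n) (@of_orbits_is_linear n).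

(** Pulling back along the orbit map is injective with image [E n]; evaluation at orbit
    representatives inverts it, and [vsproj] loses nothing because the values are fixed by T. *)
Lemma dim_invariant_cochains n :
  \dim (E n) = (#|sg_orbits X| ^ n * \dim (invariants rho))%N.
Proof.
have [r rK] := orbit_repr.
have -> : E n = limg (linfun (@of_orbits n)).
  apply/vspaceP=> f; apply/memv_capP/memv_imgP; last first.
    case=> phi _ ->; rewrite lfunE /=; split.
      apply/mem_multiavg/multiavg_fixP => z z' zz'; rewrite !ffunE.
      by congr (vsval (phi _)); apply/ffunP=> i; rewrite !ffunE zz'.
    apply/mem_lker/eqP; rewrite subr_eq0; apply/eqP/ffunP=> z.
    rewrite !ffunE; apply/esym/mem_invariants; exact: subvsP.
  case=> /mem_multiavg/multiavg_fixP fE /mem_lker/eqP.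
  rewrite subr_eq0 => /eqP Tf.
  exists [ffun y : {ffun 'I_n -> orbit_type} =>
    vsproj (invariants rho) (f [ffun i => r (y i)])]; rewrite ?memvf //.
  rewrite lfunE; apply/ffunP=> z; rewrite !ffunE vsprojK.
    by apply: fE => i; rewrite !ffunE rK.
  by apply/mem_invariants; rewrite {2}Tf ffunE.
rewrite limg_dim_eq.
  by rewrite dimvf /= /dim /= card_ffun card_ord card_orbit_type.
apply/eqP; rewrite capfv; apply/lker0P=> phi psi; rewrite !lfunE => eq_phi.
apply/ffunP=> y; apply: val_inj.
have yE : [ffun i => orbit_of ([ffun i => r (y i)] i)] = y.
  by apply/ffunP=> i; rewrite !ffunE rK.
by have /ffunP/(_ [ffun i => r (y i)]) := eq_phi; rewrite !ffunE yE.
Qed.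

End RackComplex.

Theorem corollary4p12 (X : finRackType) (M : vectType rat)
    (rho : rightModule (structure_group X) M)
    (same_operator : forall (x y : X) (v : M),
       rho v (sg_gen x) = rho v (sg_gen y))
    (n : nat) :
  \dim {: rack_cohomology rho n} =
    (#|sg_orbits X| ^ n * \dim (invariants rho))%N.
Proof.
(* Any generator provides T when X is nonempty; for empty X the identity is taken, matching the
   trivial structure group. *)
have [T [rhoT T_empty]] : exists T : {linear M -> M},
    (forall x v, rho v (sg_gen x) = T v) /\ ((X -> False) -> forall v, T v = v).
  case: (pickP (@predT X)) => [x0 _|X0].
    pose L := GRing.isLinear.Build rat M M _ _ (ract_linear rho (sg_gen x0)).
    pose T : {linear M -> M} := HB.pack (fun v : M => rho v (sg_gen x0)) L.
    by exists T; split=> [x v | /(_ x0)//]; exact: same_operator.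
  by exists idfun; split=> // x; have := X0 x.
rewrite (dim_cohomology_invariant rhoT T_empty).
exact: dim_invariant_cochains.
Qed.
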